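(* There is a polynomial $p$ such that for every $n\ge 2$ and every choice of guard functions $r,s$ (as in the context), the guarded graph tautology formula $\mathrm{GGT}_n$ has a pool resolution (regRTL) refutation with at most $p(n)$ clauses.
   Context: Clauses are sets of literals (disjunctions); a resolution inference derives $A'\lor B'$ from $A'\lor x$ and $B'\lor \overline{x}$ (with $\overline x\notin A'$, $x\notin B'$), resolving on the variable $x$. A pool resolution (regRTL) refutation of a set $F$ of clauses is a finite binary tree $T$ whose nodes are labeled by clauses such that: the root is labeled with the empty clause; each internal node is labeled with a clause obtained by a resolution inference from the clauses of its two children, together with the resolution variable; each leaf is labeled either with a clause of $F$ or with a clause (''lemma'') that labels some node occurring earlier than that leaf in the postorder of $T$ (postorder: for a node $u$, every node $v$ in the subtree of the left child of $u$ and every node $w$ in the subtree of the right child satisfy $v<w<u$); and the tree is regular, i.e. along every path from the root to a leaf, each variable is used as a resolution variable at most once. Graph tautology variables: for $[n]=\{0,\dots,n-1\}$ there are variables $x_{i,j}$ for $i<j$ in $[n]$, and for $i>j$ the notation $x_{i,j}$ denotes the literal $\overline{x}_{j,i}$ (so $\overline x_{i,j}$ and $x_{j,i}$ are the same literal). For distinct $i,j,k$, $T_{i,j,k}$ is the clause $\overline x_{i,j}\lor\overline x_{j,k}\lor\overline x_{k,i}$. Let $r,s:[n]^3\to[n]$ be functions such that for all distinct $i,j,k$: $r(i,j,k)\neq s(i,j,k)$, $\{r(i,j,k),s(i,j,k)\}\not\subseteq\{i,j,k\}$, and $r(i,j,k)=r(j,k,i)=r(k,i,j)$, $s(i,j,k)=s(j,k,i)=s(k,i,j)$.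 The formula $\mathrm{GGT}_n$ consists of the clauses $\bigvee_{j\ne i}x_{j,i}$ for each $i\in[n]$, and, for all distinct $i,j,k\in[n]$ with $r=r(i,j,k)$, $s=s(i,j,k)$, the two guarded transitivity clauses $T_{i,j,k}\lor x_{r,s}$ and $T_{i,j,k}\lor\overline x_{r,s}$. *)

(* Defs.v *)
From mathcomp Require Import all_boot all_algebra.

Set Implicit Arguments.
Unset Strict Implicit.
Unset Printing Implicit Defensive.

Section PoolResolution.
Variable V : finType.

(* The literals are the pairs (x, true), for x, and (x, false), for its
   negation. *)
Definition clause : Type := {set V * bool}.

(* With A = A' \/ x and B = B' \/ ~x, the side clauses A' and B' contain
   neither x nor its negation. *)
Definition resolvent (x : V) (A B C : clause) : Prop :=
  [/\ (x, true) \in A, (x, false) \notin A,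
      (x, false) \in B, (x, true) \notin B
    & C = (A :\ (x, true)) :|: (B :\ (x, false))].

(* Res C x t1 t2 is an internal node labeled by the clause C and the
   resolution variable x, with left subtree t1 and right subtree t2. *)
Inductive rtree : Type :=
  | Leaf of clause
  | Res of clause & V & rtree & rtree.

Definition label (t : rtree) : clause :=
  match t with Leaf C => C | Res C _ _ _ => C end.

Fixpoint num_nodes (t : rtree) : nat :=
  match t with
  | Leaf _ => 1
  | Res _ _ t1 t2 => (num_nodes t1 + num_nodes t2).+1
  end.

(* Nodes are addressed by the path from the root: false goes to the left child
   and true to the right one; subtree t u is None when t has no node u. *)
Fixpoint subtree (t : rtree) (u : seq bool) : option rtree :=
  match u, t with
  | [::], _ => Some t
  | b :: u', Res _ _ t1 t2 => subtree (if b then t2 else t1) u'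
  | _ :: _, Leaf _ => None
  end.

(* v comes strictly before w in the postorder: v is a proper descendant of w, or
   v lies to the left of w below their lowest common ancestor. *)
Fixpoint postorder_lt (v w : seq bool) : bool :=
  match v, w with
  | [::], _ => false
  | _ :: _, [::] => true
  | a :: v', b :: w' => if a == b then postorder_lt v' w' else ~~ a && b
  end.

(* The sequences of resolution variables along the root-to-leaf paths. *)
Fixpoint branches (t : rtree) : seq (seq V) :=
  match t with
  | Leaf _ => [:: [::]]
  | Res _ x t1 t2 => [seq x :: p | p <- branches t1 ++ branches t2]
  end.

Definition regular (t : rtree) : bool := all uniq (branches t).

(* Either child of an internal node may carry the positive occurrence of the
   resolution variable. *)
Definition pool_refutation (F : {set clause}) (t : rtree) : Prop :=
  [/\ label t = set0,
      forall (u : seq bool) C x t1 t2, subtree t u = Some (Res C x t1 t2) ->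
        resolvent x (label t1) (label t2) C \/
        resolvent x (label t2) (label t1) C,
      forall (u : seq bool) C, subtree t u = Some (Leaf C) ->
        C \in F \/
        exists (v : seq bool) (t' : rtree),
          [/\ postorder_lt v u, subtree t v = Some t' & label t' = C]
    & regular t].

End PoolResolution.

Section GuardedGraphTautology.
Variable n : nat.

Definition gvar : Type := {ij : 'I_n * 'I_n | ij.1 < ij.2}.

(* The unit clause consisting of the literal x_{i,j}: the variable x_{i,j} if
   i < j, the negation of the variable x_{j,i} if i > j (empty if i = j). The
   negation of x_{i,j} is x_{j,i}. *)
Definition unit_clause (i j : 'I_n) : clause gvar :=
  [set l | val l.1 == if l.2 then (i, j) else (j, i)].

Lemma unit_clause_pos (i j : 'I_n) (h : i < j) :
  unit_clause i j = [set (exist _ (i, j) h : gvar, true)].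
Proof.
apply/setP=> -[[[a b] /= hab] []]; rewrite !inE !xpair_eqE -val_eqE /= ?andbT //.
rewrite andbF; apply/negP=> /andP[/eqP ea /eqP eb].
by move: hab; rewrite ea eb /= ltnNge ltnW.
Qed.

Lemma unit_clause_neg (i j : 'I_n) (h : j < i) :
  unit_clause i j = [set (exist _ (j, i) h : gvar, false)].
Proof.
apply/setP=> -[[[a b] /= hab] []]; rewrite !inE !xpair_eqE -val_eqE /= ?andbT //.
rewrite andbF; apply/negP=> /andP[/eqP ea /eqP eb].
by move: hab; rewrite ea eb /= ltnNge ltnW.
Qed.

Definition total_clause (i : 'I_n) : clause gvar :=
  \bigcup_(j : 'I_n | j != i) unit_clause j i.

(* ~x_{i,j} \/ ~x_{j,k} \/ ~x_{k,i} *)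
Definition trans_clause (i j k : 'I_n) : clause gvar :=
  unit_clause j i :|: unit_clause k j :|: unit_clause i k.

Definition guard_functions (r s : 'I_n -> 'I_n -> 'I_n -> 'I_n) : Prop :=
  forall i j k : 'I_n, i != j -> j != k -> i != k ->
    [/\ r i j k != s i j k,
        ~~ ([set r i j k; s i j k] \subset [set i; j; k]),
        r i j k = r j k i /\ r j k i = r k i j
      & s i j k = s j k i /\ s j k i = s k i j].

Definition GGT (r s : 'I_n -> 'I_n -> 'I_n -> 'I_n) : {set clause gvar} :=
  [set total_clause i | i : 'I_n] :|:
  [set C | [exists i, exists j, exists k,
     [&& i != j, j != k, i != k &
         (C == trans_clause i j k :|: unit_clause (r i j k) (s i j k)) ||
         (C == trans_clause i j k :|: unit_clause (s i j k) (r i j k))]]].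

End GuardedGraphTautology.

(* Main.v *)
Require Import Defs.
From mathcomp Require Import all_boot all_algebra.
From mathcomp Require Import zify.

Set Implicit Arguments.
Unset Strict Implicit.
Unset Printing Implicit Defensive.

(** Work at a node whose path has set the variables in w so that every
    non-minimal element has a unique minimal predecessor.  If every transitivity
    clause that the polynomial-size regular refutation of GT uses on the minimal
    elements is either already learned or has its guard variable set by w (so that
    one of its two guarded versions only adds a falsified literal), that refutation
    is a regular dag below the node, and becomes a tree with lemmas.  Otherwise
    some such T_{a,b,c} has an unset guard variable: branch on the comparisons of
    a, b, c.  The leftmost branch falsifies T_{a,b,c}, which is learned by
    resolving on its guard variable; in at most three other branches some minimal
    elements become non-minimal, and their successors are moved below a minimal
    element one at a time, at the cost of one falsified transitivity clause each.
    Every stage learns a new clause, so there are O(n^3) stages.  Since lemmas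
    forbid dropping subtrees, weakening is not available: the invariant is that the
    label contains, for each non-minimal k with minimal predecessor m, the
    negation of m < k. *)

(** * Trees with lemmas: left-to-right validity, regularity, and passage to pool refutations *)

Section Trees.
Variables (V : finType) (F : {set clause V}).
Implicit Types (L : {set clause V}) (t : rtree V).

Fixpoint labels t : {set clause V} :=
  match t with
  | Leaf C => [set C]
  | Res C _ t1 t2 => C |: (labels t1 :|: labels t2)
  end.

Fixpoint tvars t : {set V} :=
  match t with
  | Leaf _ => set0
  | Res _ x t1 t2 => x |: (tvars t1 :|: tvars t2)
  end.

(* The left-to-right reading of the lemma condition of pool resolution, with
   the clauses of L as initially available lemmas. *)
Fixpoint valid L t : Prop :=
  match t with
  | Leaf C => C \in F :|: L
  | Res C x t1 t2 =>
    [/\ resolvent x (label t1) (label t2) C \/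
        resolvent x (label t2) (label t1) C,
        valid L t1 & valid (L :|: labels t1) t2]
  end.

Lemma label_labels t : label t \in labels t.
Proof. by case: t => [C|C x t1 t2] /=; rewrite !inE eqxx. Qed.

Lemma branches_tvars t (b : seq V) x : b \in branches t -> x \in b -> x \in tvars t.
Proof.
elim: t b => [C|C y t1 IH1 t2 IH2] b /=; first by rewrite inE => /eqP->.
case/mapP=> b'; rewrite mem_cat => hb' ->; rewrite !inE => /orP[->//|xb'].
by case/orP: hb' => hb'; rewrite ?(IH1 _ hb' xb') ?(IH2 _ hb' xb') ?orbT.
Qed.

Lemma regular_Res C x t1 t2 :
  x \notin tvars t1 -> x \notin tvars t2 -> regular t1 -> regular t2 ->
  regular (Res C x t1 t2).
Proof.
move=> x1 x2 /allP r1 /allP r2; apply/allP=> b /mapP[b'].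
rewrite mem_cat => hb' -> /=.
case/orP: hb' => hb'; rewrite ?(r1 _ hb') ?(r2 _ hb') andbT.
  by apply: contra x1; apply: branches_tvars.
by apply: contra x2; apply: branches_tvars.
Qed.

Lemma labels_subtree t C :
  C \in labels t -> exists u t', subtree t u = Some t' /\ label t' = C.
Proof.
elim: t => [D|D x t1 IH1 t2 IH2] /=.
  by rewrite inE => /eqP->; exists [::], (Leaf D).
rewrite !inE => /orP[/eqP->|/orP[/IH1|/IH2] [u [t' [h1 h2]]]].
- by exists [::], (Res D x t1 t2).
- by exists (false :: u), t'.
- by exists (true :: u), t'.
Qed.

Lemma valid_resolvent L t u C x t1 t2 :
  valid L t -> subtree t u = Some (Res C x t1 t2) ->
  resolvent x (label t1) (label t2) C \/ resolvent x (label t2) (label t1) C.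
Proof.
elim: t L u => [D|D y s1 IH1 s2 IH2] L [|b u] //=.
  by case=> h _ _ [<- <- <- <-].
by case=> _ h1 h2; case: b; [apply: IH2 h2 | apply: IH1 h1].
Qed.

(** A lemma outside [L] labels a node in the left sibling subtree of some ancestor-or-self of the
    leaf, hence precedes it in the postorder. *)
Lemma valid_leaf L t u C :
  valid L t -> subtree t u = Some (Leaf C) ->
  C \in F :|: L \/
  exists (v : seq bool) (t' : rtree V),
    [/\ postorder_lt v u, subtree t v = Some t' & label t' = C].
Proof.
elim: t L u => [D|D y s1 IH1 s2 IH2] L [|b u] //=.
  by move=> h [<-]; left.
case=> _ h1 h2; case: b => hu; last first.
  case: (IH1 _ _ h1 hu) => [|[v [t' [a1 a2 a3]]]]; first by left.
  by right; exists (false :: v), t'.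
case: (IH2 _ _ h2 hu) => [|[v [t' [a1 a2 a3]]]]; last first.
  by right; exists (true :: v), t'.
rewrite setUA inE => /orP[|/labels_subtree[v [t' [a1 a2]]]]; first by left.
by right; exists (false :: v), t'.
Qed.

Lemma valid_pool_refutation t :
  label t = set0 -> regular t -> valid set0 t -> pool_refutation F t.
Proof.
move=> t0 treg tv; split=> // [u C x t1 t2|u C hu].
  exact: valid_resolvent tv.
by case: (valid_leaf tv hu) => [|h]; [rewrite setU0; left | right].
Qed.

End Trees.

(** * Literals x_{i,j} indexed by ordered pairs of distinct elements *)

Section Literals.
Variables (n : nat) (v0 : gvar n).
Implicit Types i j a b c : 'I_n.

(** [v0] is a mere default, returned when [i = j]; for distinct indices the sorted pair is a
    variable. *)
Definition var i j : gvar n := insubd v0 (if i < j then (i, j) else (j, i)).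

(* The literal x_{i,j}; meaningful only for i != j. *)
Definition lit i j : gvar n * bool := (var i j, i < j).

Lemma neq_ltP i j : i != j -> (i < j) || (j < i).
Proof. by rewrite -val_eqE neq_ltn. Qed.

Lemma val_var i j : i != j -> val (var i j) = if i < j then (i, j) else (j, i).
Proof.
move=> /neq_ltP ij; rewrite /var /insubd insubT //=.
by case: ltnP ij => //= ->.
Qed.

Lemma var_eq i j a b : i != j -> a != b -> var i j = var a b ->
  (i = a /\ j = b) \/ (i = b /\ j = a).
Proof.
move=> ij ab /(congr1 val); rewrite !val_var //.
by do 2![case: ifP => _]; case=> -> ->; auto.
Qed.

Lemma varC i j : i != j -> var i j = var j i.
Proof.
move=> ij; apply: val_inj; rewrite !val_var // 1?eq_sym //.
by move: ij; rewrite -val_eqE; case: ltngtP.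
Qed.

Lemma lit_eq i j a b : i != j -> a != b -> lit i j = lit a b -> i = a /\ j = b.
Proof.
move=> ij ab [e1 e2]; case: (var_eq ij ab e1) => [//|[ea eb]].
move: ij e2; rewrite ea eb -val_eqE; case: ltngtP => //.
Qed.

Lemma litP (l : gvar n * bool) : exists i j, i != j /\ l = lit i j.
Proof.
case: l => -[[i j] /= h] []; [exists i, j | exists j, i].
  have ij : i != j by rewrite -val_eqE neq_ltn h.
  split=> //; congr (_, _); last by rewrite h.
  by apply: val_inj; rewrite val_var // h.
have ij : j != i by rewrite -val_eqE neq_ltn h orbT.
split=> //; congr (_, _); last by rewrite ltnNge ltnW.
by apply: val_inj; rewrite val_var // ltnNge ltnW.
Qed.

Lemma in_unit i j a b : i != j ->
  (lit i j \in unit_clause a b) = (i == a) && (j == b).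
Proof.
move=> ij; rewrite inE /= val_var //; case: ltnP => _; rewrite xpair_eqE //.
by rewrite andbC.
Qed.

Lemma in_trans i j a b c : i != j ->
  (lit i j \in trans_clause a b c) =
  [|| (i == b) && (j == a), (i == c) && (j == b) | (i == a) && (j == c)].
Proof. by move=> ij; rewrite !inE -!orbA -3!(in_unit _ _ ij) !inE. Qed.

Lemma in_total i j a : i != j -> (lit i j \in total_clause a) = (j == a).
Proof.
move=> ij; apply/bigcupP/eqP => [[b ba]|<-].
  by rewrite in_unit // => /andP[_ /eqP].
by exists i; rewrite // in_unit // !eqxx.
Qed.

Lemma clause_ext (C D : clause (gvar n)) :
  (forall i j, i != j -> (lit i j \in C) = (lit i j \in D)) -> C = D.
Proof. by move=> h; apply/setP=> l; case: (litP l) => i [j [ij ->]]; apply: h. Qed.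

Definition res a b (t1 t2 : rtree (gvar n)) : rtree (gvar n) :=
  Res ((label t1 :\ lit a b) :|: (label t2 :\ lit b a)) (var a b) t1 t2.

Lemma in_res i j a b t1 t2 : i != j -> a != b ->
  (lit i j \in label (res a b t1 t2)) =
  ~~ ((i == a) && (j == b)) && (lit i j \in label t1)
  || ~~ ((i == b) && (j == a)) && (lit i j \in label t2).
Proof.
move=> ij ab; have ba : b != a by rewrite eq_sym.
have e x y : x != y -> (lit i j == lit x y) = (i == x) && (j == y).
  move=> xy; apply/eqP/andP => [/(lit_eq ij xy)[-> ->]|[/eqP-> /eqP->]] //.
by rewrite !inE !e.
Qed.

Lemma resolvent_res a b t1 t2 : a != b ->
  lit a b \in label t1 -> lit b a \notin label t1 ->
  lit b a \in label t2 -> lit a b \notin label t2 ->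
  resolvent (var a b) (label t1) (label t2) (label (res a b t1 t2)) \/
  resolvent (var a b) (label t2) (label t1) (label (res a b t1 t2)).
Proof.
move=> ab; have := ab; rewrite -val_eqE /res /lit (@varC b a) 1?eq_sym //=.
by case: ltngtP => // _ _ *; [left | right]; split=> //; rewrite setUC.
Qed.

End Literals.

(** * Derivations with bounded labels and reserved variables *)

Section Derivations.
Variables (n : nat) (v0 : gvar n) (F : {set clause (gvar n)}).
Implicit Types (i j a b c : 'I_n) (L : {set clause (gvar n)}).
Implicit Types (X lo hi : rel 'I_n) (t : rtree (gvar n)).
Local Notation lit := (lit v0).
Local Notation var := (var v0).
Local Notation res := (res v0).

(* The label of t lies between the clauses lo and hi, and t does not resolve on
   the variables in X; a pair (i, j) stands for x_{i,j}. *)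
Definition derives L X lo hi t : Prop :=
  [/\ valid F L t, regular t,
      forall i j, i != j -> var i j \in tvars t -> ~~ X i j,
      forall i j, i != j -> lo i j -> lit i j \in label t
    & forall i j, i != j -> lit i j \in label t -> hi i j].

Definition single a b : rel 'I_n := fun i j => (i == a) && (j == b).

Definition rel_or X lo : rel 'I_n := fun i j => X i j || lo i j.

Lemma single_refl a b : single a b a b.
Proof. by rewrite /single !eqxx. Qed.

Lemma valid_mono L L' t : L \subset L' -> valid F L t -> valid F L' t.
Proof.
elim: t L L' => [C|C x t1 IH1 t2 IH2] L L' sL /=.
  by apply/subsetP/setUS.
case=> r v1 v2; split=> //; first exact: IH1 v1.
by apply: IH2 v2; apply: setSU.
Qed.

Lemma derives_weak L L' X X' lo lo' hi hi' t :
  derives L X lo hi t -> L \subset L' ->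
  (forall i j, i != j -> X' i j -> X i j) ->
  (forall i j, i != j -> lo' i j -> lo i j) ->
  (forall i j, i != j -> hi i j -> hi' i j) -> derives L' X' lo' hi' t.
Proof.
move=> [v g x l h] sL hX hlo hhi; split=> //.
- exact: valid_mono v.
- by move=> i j ij /(x i j ij); apply: contra; apply: hX.
- by move=> i j ij /(hlo _ _ ij); apply: l.
- by move=> i j ij /(h i j ij); apply: hhi.
Qed.

Lemma derives_leaf L X lo hi C : C \in F :|: L ->
  (forall i j, i != j -> lo i j -> lit i j \in C) ->
  (forall i j, i != j -> lit i j \in C -> hi i j) -> derives L X lo hi (Leaf C).
Proof. by move=> CL hlo hhi; split=> // i j ij; rewrite inE. Qed.

(** Regularity holds because [X1] and [X2] already ban the resolution variable in both subtrees. The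
    upper bounds keep the opposite literal out of each premise. *)
Lemma derives_res L X X1 X2 lo lo1 lo2 hi hi1 hi2 a b t1 t2 :
  a != b -> ~~ rel_or X hi a b -> ~~ rel_or X hi b a -> ~~ lo a b -> ~~ lo b a ->
  derives L X1 lo1 hi1 t1 -> derives (L :|: labels t1) X2 lo2 hi2 t2 ->
  lo1 a b -> lo2 b a ->
  (forall i j, i != j -> hi1 i j -> rel_or hi (single a b) i j) ->
  (forall i j, i != j -> hi2 i j -> rel_or hi (single b a) i j) ->
  (forall i j, i != j -> X i j -> X1 i j && X2 i j) ->
  X1 a b -> X2 a b ->
  (forall i j, i != j -> lo i j -> rel_or lo1 lo2 i j) ->
  derives L X lo hi (res a b t1 t2).
Proof.
move=> ab Xab Xba loab loba [v1 g1 x1 l1 h1] [v2 g2 x2 l2 h2] lo1ab lo2ba.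
move=> hhi1 hhi2 hX X1ab X2ab hlo.
have ba : b != a by rewrite eq_sym.
move: Xab Xba; rewrite /rel_or !negb_or => /andP[Xab hab] /andP[Xba hba].
have sab : single a b b a = false by rewrite /single (negPf ba).
have sba : single b a a b = false by rewrite /single (negPf ab).
have f1 : lit b a \notin label t1.
  by apply/negP=> /(h1 _ _ ba) /(hhi1 _ _ ba); rewrite /rel_or (negPf hba) sab.
have f2 : lit a b \notin label t2.
  by apply/negP=> /(h2 _ _ ab) /(hhi2 _ _ ab); rewrite /rel_or (negPf hab) sba.
split.
- split=> //; apply: resolvent_res => //; [exact: l1 | exact: l2].
- apply: regular_Res => //.
    by apply/negP=> /(x1 _ _ ab); rewrite X1ab.
  by apply/negP=> /(x2 _ _ ab); rewrite X2ab.
- move=> i j ij; rewrite !inE => /orP[/eqP/(var_eq ij ab)|/orP[]].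
  + by case=> -[-> ->].
  + by move/(x1 _ _ ij); apply: contra => /(hX _ _ ij)/andP[].
  + by move/(x2 _ _ ij); apply: contra => /(hX _ _ ij)/andP[].
- move=> i j ij hl; rewrite in_res //.
  case: (boolP ((i == a) && (j == b))) hl => [/andP[/eqP-> /eqP->]|_].
    by rewrite (negPf loab).
  case: (boolP ((i == b) && (j == a))) => [/andP[/eqP-> /eqP->]|_].
    by rewrite (negPf loba).
  by move/(hlo _ _ ij)/orP => [/(l1 _ _ ij)|/(l2 _ _ ij)] ->; rewrite ?orbT.
- move=> i j ij; rewrite in_res // => /orP[]/andP[nab].
    by move/(h1 _ _ ij)/(hhi1 _ _ ij)/orP => []; rewrite // /single (negPf nab).
  by move/(h2 _ _ ij)/(hhi2 _ _ ij)/orP => []; rewrite // /single (negPf nab).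
Qed.

(** A linear chain: resolving [t] with each [C j] in turn removes x_{j,e} for [j] in [js]. Every
    step adds one leaf and one inner node, whence [2 * size js]. *)
Lemma derives_seq L X lo0 lo hi e (C : 'I_n -> clause (gvar n)) js t :
  uniq js -> e \notin js ->
  (forall j, j \in js -> ~~ rel_or X hi j e && ~~ rel_or X hi e j) ->
  derives L (fun i j => [|| X i j, (i \in js) && (j == e) | (i == e) && (j \in js)])
    lo0 (fun i j => hi i j || (i \in js) && (j == e)) t ->
  (forall j, j \in js -> lo0 j e) ->
  (forall j, j \in js -> C j \in F :|: (L :|: labels t)) ->
  (forall j, j \in js -> lit e j \in C j) ->
  (forall j i k, j \in js -> i != k -> lit i k \in C j ->
     rel_or hi (single e j) i k) ->
  (forall i k, i != k -> lo i k -> hi i k) ->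
  (forall i k, i != k -> lo i k -> lo0 i k || has (fun j => lit i k \in C j) js) ->
  exists t', [/\ derives L X lo hi t', labels t \subset labels t' &
                 num_nodes t' = num_nodes t + 2 * size js].
Proof.
elim: js lo0 t => [|j js IH] lo0 t.
  move=> _ _ _ d _ _ _ _ _ h2; exists t; split=> //; last by rewrite addn0.
  apply: derives_weak d _ _ _ _ => // [i j _|i j ij|i j _].
  - by rewrite !in_nil andbF !orbF.
  - by move/(h2 _ _ ij); rewrite orbF.
  - by rewrite in_nil orbF.
move=> /andP[jjs ujs]; rewrite inE negb_or => /andP[ej ejs] hX d l0 CL hC hC2 h1 h2.
have je : j != e by rewrite eq_sym.
have jin : j \in j :: js by rewrite inE eqxx.
have /andP[Xje Xej] := hX j jin.
have sub k : k \in js -> k \in j :: js by rewrite inE orbC => ->.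
pose hi' : rel 'I_n := fun i k => hi i k || (i \in js) && (k == e).
pose X' : rel 'I_n := fun i k =>
  [|| X i k, (i \in js) && (k == e) | (i == e) && (k \in js)].
(* Intersecting with [hi'] discards both literals of the variable just resolved on. *)
pose lo' : rel 'I_n := fun i k => hi' i k && (lo0 i k || (lit i k \in C j)).
have hi'je : ~~ rel_or X' hi' j e.
  move: Xje; rewrite /rel_or /X' /hi' (negPf je) (negPf jjs) /= !orbF.
  by [].
have hi'ej : ~~ rel_or X' hi' e j.
  move: Xej; rewrite /rel_or /X' /hi' (negPf ejs) (negPf jjs) /= andbF !orbF.
  by [].
have d2 : derives (L :|: labels t) (fun=> xpredT) (fun i k => lit i k \in C j)
    (rel_or hi (single e j)) (Leaf (C j)).
  by apply: derives_leaf => [|//|i k ik]; [apply: CL | apply: hC2].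
have d' : derives L X' lo' hi' (res j e t (Leaf (C j))).
  apply: (derives_res je hi'je hi'ej _ _ d d2) => //.
  - by move: hi'je; rewrite /lo' /rel_or negb_or => /andP[_ /negPf->].
  - by move: hi'ej; rewrite /lo' /rel_or negb_or => /andP[_ /negPf->].
  - exact: l0.
  - exact: hC.
  - move=> i k _; rewrite /rel_or /hi' /single inE.
    by case: (hi i k); case: (i == j); case: (i \in js); case: (k == e).
  - move=> i k _; rewrite /rel_or /hi' /single.
    by case: (hi i k) => //= ->; rewrite orbT.
  - move=> i k _; rewrite /X' !inE andbT => /or3P[->//|/andP[-> ->]|/andP[-> ->]];
    by rewrite !orbT.
  - by rewrite jin eqxx orbT.
  - by move=> i k _ /andP[].
case: (IH _ _ ujs ejs _ d').
- by move=> k /sub/hX.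
- move=> k kjs; rewrite /lo' /hi' kjs eqxx orbT l0 //; exact: sub.
- move=> k /sub/CL; rewrite /= !inE => /or3P[->//|->|->]; rewrite ?orbT //.
- by move=> k /sub/hC.
- by move=> i k l /sub; apply: hC2.
- exact: h1.
- move=> i k ik lik; rewrite /lo' /hi' h1 //=.
  by have := h2 _ _ ik lik; rewrite /= orbA.
move=> t' [dt' st' nt']; exists t'; split=> //.
  by apply: subset_trans st'; apply/subsetP=> D hD; rewrite !inE hD orbT.
by rewrite nt' /= mulnS addnA addn1 addn2.
Qed.

End Derivations.

(* A partial assignment w (w i j means that x_{i,j} is set to true) under which
   every element that is not minimal has exactly one minimal predecessor, given
   by p; the minimal elements are the fixed points of p. *)
Record forest n (w : rel 'I_n) (p : 'I_n -> 'I_n) : Prop := Forest {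
  forest_anti : forall i j, w i j -> ~~ w j i;
  forest_root : forall i j, w i j -> p j != j;
  forest_parent : forall i, p i != i -> w (p i) i;
  forest_uniq : forall m k, p m = m -> w m k -> p k = m;
  forest_idem : forall i, p (p i) = p i }.

(** * Guarded transitivity clauses under a partial assignment *)

Section Guards.
Variables (n : nat) (v0 : gvar n) (r s : 'I_n -> 'I_n -> 'I_n -> 'I_n).
Hypothesis rs : guard_functions r s.
Implicit Types (i j a b c e : 'I_n) (L : {set clause (gvar n)}).
Implicit Types (w : rel 'I_n) (A : seq 'I_n).
Local Notation lit := (lit v0).
Local Notation res := (res v0).
Local Notation F := (GGT r s).
Local Notation derives := (derives v0 F).

Definition guard_set w a b c := w (r a b c) (s a b c) || w (s a b c) (r a b c).

Definition available L w a b c :=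
  (trans_clause a b c \in L) || guard_set w a b c.

(* T_{a,b,c}, possibly with a guard literal; meaningful only if available. *)
Definition trans_variant L w a b c : clause (gvar n) :=
  if trans_clause a b c \in L then trans_clause a b c
  else if w (r a b c) (s a b c)
    then trans_clause a b c :|: unit_clause (s a b c) (r a b c)
    else trans_clause a b c :|: unit_clause (r a b c) (s a b c).

Lemma guarded_in_GGT a b c : a != b -> b != c -> a != c ->
  (trans_clause a b c :|: unit_clause (r a b c) (s a b c) \in F) &&
  (trans_clause a b c :|: unit_clause (s a b c) (r a b c) \in F).
Proof.
move=> ab bc ac; rewrite !inE; apply/andP; split; apply/orP; right;
by apply/existsP; exists a; apply/existsP; exists b; apply/existsP; exists c;
  rewrite ab bc ac eqxx ?orbT.
Qed.

Lemma total_in_GGT i : total_clause i \in F.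
Proof. by rewrite inE; apply/orP; left; apply/imsetP; exists i. Qed.

(** If the guard variable is set, the version chosen is the one whose guard literal is false under
    [w], so the surplus over T_{a,b,c} is a falsified literal. *)
Lemma trans_variantP L w a b c : a != b -> b != c -> a != c ->
  available L w a b c ->
  [/\ trans_variant L w a b c \in F :|: L,
      forall i j, i != j -> lit i j \in trans_clause a b c ->
        lit i j \in trans_variant L w a b c
    & forall i j, i != j -> lit i j \in trans_variant L w a b c ->
        (lit i j \in trans_clause a b c) || w j i].
Proof.
move=> ab bc ac; rewrite /available /guard_set /trans_variant.
have /andP[h1 h2] := guarded_in_GGT ab bc ac.
case: ifP => [TL _|_ /=]; first by split=> [|//|i j _ ->//]; rewrite inE TL orbT.
case: ifP => [w1 _|_ /= w2]; split; try by rewrite inE ?h1 ?h2.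
- by move=> i j _ h; rewrite in_setU h.
- move=> i j ij; rewrite in_setU in_unit // => /orP[->//|/andP[/eqP-> /eqP->]].
  by rewrite w1 orbT.
- by move=> i j _ h; rewrite in_setU h.
- move=> i j ij; rewrite in_setU in_unit // => /orP[->//|/andP[/eqP-> /eqP->]].
  by rewrite w2 orbT.
Qed.

(** * The regular dag refutation of the graph tautology, unfolded into a tree with lemmas *)

Section Dag.
Variables (L0 : {set clause (gvar n)}) (w : rel 'I_n) (p : 'I_n -> 'I_n).
Hypothesis wp : forest w p.
Hypothesis availR : forall a b c, p a = a -> p b = b -> p c = c ->
  a != b -> b != c -> a != c -> available L0 w a b c.
Hypothesis availP : forall j i, p j != j -> p i = i -> i != p j ->
  available L0 w (p j) j i.

Lemma root_min i j : p j = j -> w i j = false.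
Proof. by move=> pj; apply/negP=> /(forest_root wp); rewrite pj eqxx. Qed.

(* The derived clauses are \/_{a in A} x_{a,i}, weakened by w-falsified literals
   that include all the literals p a < a. *)
Definition goal_lo A i : rel 'I_n := fun a b => (b == i) && (a \in A) || (b == p a).
Definition goal_hi A i : rel 'I_n := fun a b => (b == i) && (a \in A) || w b a.
(** Variables inside [A] are reserved: they are resolved on nearer the root, where [A] loses its
    elements one by one. *)
Definition goal_vars A : rel 'I_n :=
  fun a b => [|| w a b, w b a | (a \in A) && (b \in A)].

Definition goal_derives L A i := derives L (goal_vars A) (goal_lo A i) (goal_hi A i).

Lemma size_uniq_ord A : uniq A -> size A <= n.
Proof. by move/card_uniqP <-; rewrite -[X in _ <= X]card_ord max_card. Qed.

(** Start from the clause \/_{j <> i} x_{j,i}. A non-minimal [j] with [p j = i] contributes a false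
    literal; for any other non-minimal [j], T_{p j,j,i} replaces x_{j,i} by x_{p j,i}. *)
Lemma dag_base ms i : uniq ms -> (forall a, (a \in ms) = (p a == a)) -> i \in ms ->
  exists t, goal_derives L0 ms i t /\ num_nodes t <= 2 * n + 1.
Proof.
move=> ums msE; rewrite msE => /eqP pi.
pose js := [seq j <- enum 'I_n | (p j != j) && (p j != i)].
have jsE j : (j \in js) = (p j != j) && (p j != i).
  by rewrite mem_filter mem_enum inE andbT.
have ujs : uniq js by rewrite filter_uniq ?enum_uniq.
have dist j : j \in js -> [&& p j != j, j != i, p j != i & i != p j].
  rewrite jsE => /andP[-> h]; rewrite h [i == _]eq_sym h !andbT /=.
  by apply: contraNneq h => ->; rewrite pi.
have spec j : j \in js -> [/\ trans_variant L0 w (p j) j i \in F :|: L0,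
      forall a b, a != b -> lit a b \in trans_clause (p j) j i ->
        lit a b \in trans_variant L0 w (p j) j i
    & forall a b, a != b -> lit a b \in trans_variant L0 w (p j) j i ->
        (lit a b \in trans_clause (p j) j i) || w b a].
  by move/dist/and4P=> [h1 h2 h3 h4]; apply: trans_variantP => //; apply: availP.
have iNjs : i \notin js by rewrite jsE pi eqxx.
have hX : forall j, j \in js ->
    ~~ rel_or (goal_vars ms) (goal_hi ms i) j i &&
    ~~ rel_or (goal_vars ms) (goal_hi ms i) i j.
  move=> j hj; have /and4P[h1 h2 h3 h4] := dist j hj.
  have wij : w i j = false.
    by apply/negP=> /(forest_uniq wp pi) e; rewrite e eqxx in h3.
  rewrite /rel_or /goal_vars /goal_hi /= wij root_min // !msE eqxx (negPf h1) (negPf h2).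
  by rewrite /= andbF.
have dl : derives L0 (fun a b => [|| goal_vars ms a b, (a \in js) && (b == i)
                                    | (a == i) && (b \in js)])
    (fun a b => b == i) (fun a b => goal_hi ms i a b || (a \in js) && (b == i))
    (Leaf (total_clause i)).
  apply: derives_leaf => [|a b ab|a b ab].
  - by rewrite inE total_in_GGT.
  - by rewrite in_total.
  - rewrite in_total // => /eqP->; rewrite /goal_hi eqxx andbT /= msE jsE.
    case: eqP => //= /eqP pa; case: eqP => [<-|]; last by rewrite orbT.
    by rewrite (forest_parent wp).
case: (derives_seq (lo := goal_lo ms i) (C := fun j => trans_variant L0 w (p j) j i)
   ujs iNjs hX dl).
- by [].
- by move=> j /spec[+ _ _]; rewrite !inE => /orP[->|->]; rewrite ?orbT.
- move=> j hj; have [_ h _] := spec j hj; have /and4P[h1 h2 h3 h4] := dist j hj.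
  by apply: h; rewrite 1?eq_sym // in_trans 1?eq_sym // !eqxx ?orbT.
- move=> j a b hj ab; have [_ _ h] := spec j hj.
  have /and4P[h1 h2 h3 h4] := dist j hj.
  move/(h _ _ ab); rewrite in_trans // /rel_or /goal_hi /single /= msE -!orbA.
  case/or4P => [/andP[/eqP-> /eqP->]|/andP[-> ->]|/andP[/eqP-> ->]|->];
    rewrite ?orbT //.
    by rewrite (forest_parent wp) ?orbT.
  by rewrite (forest_idem wp) eqxx.
- move=> a b ab; rewrite /goal_lo /goal_hi => /orP[->//|/eqP bp].
  by rewrite bp (forest_parent wp) ?orbT // -bp eq_sym.
- move=> a b ab; rewrite /goal_lo => /orP[/andP[->]//|/eqP bp].
  case: eqP => //= /eqP bi; apply/hasP; exists a.
    by rewrite jsE -bp bi eq_sym ab.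
  have aj : a \in js by rewrite jsE -bp bi eq_sym ab.
  by have [_ h _] := spec a aj; apply: h; rewrite // in_trans // bp !eqxx.
move=> t [dt _ nt]; exists t; split=> //; rewrite nt /= addnC leq_add2r leq_mul2l /=.
exact: size_uniq_ord.
Qed.

(** Eliminates [e]: resolving \/_{a in A} x_{a,e} with T_{j,e,i} for each [j] in [A] other than [i]
    turns x_{j,e} into x_{j,i} and leaves x_{i,e}, which is cut against \/_{a in A} x_{a,i} \/
    x_{e,i}. That second premise may use the labels of [t1] as lemmas. *)
Lemma dag_step L e A i t1 K : L0 \subset L -> uniq (e :: A) ->
  (forall a, a \in e :: A -> p a = a) -> i \in A -> goal_derives L (e :: A) e t1 ->
  (forall L', L :|: labels t1 \subset L' ->
     exists t2, goal_derives L' (e :: A) i t2 /\ num_nodes t2 <= K) ->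
  exists t, [/\ goal_derives L A i t, labels t1 \subset labels t &
                num_nodes t <= num_nodes t1 + (2 * n + 1 + K)].
Proof.
move=> sL /andP[eA uA] rA iA d1 hd2.
have re : p e = e by apply: rA; rewrite inE eqxx.
have rAA a : a \in A -> p a = a by move=> aA; apply: rA; rewrite inE aA orbT.
have ri := rAA i iA.
have ei : e != i by apply: contraNneq eA => ->.
have ie : i != e by rewrite eq_sym.
pose js := [seq j <- A | j != i].
have jsE j : (j \in js) = (j != i) && (j \in A) by rewrite mem_filter.
have ujs : uniq js by rewrite filter_uniq.
have dist j : j \in js -> [/\ j != i, j \in A, p j = j, j != e & e != j].
  rewrite jsE => /andP[-> jA].
  have je : j != e by apply: contraNneq eA => <-.
  by rewrite jA rAA // je eq_sym.
have spec j : j \in js -> [/\ trans_variant L0 w j e i \in F :|: L0,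
      forall a b, a != b -> lit a b \in trans_clause j e i ->
        lit a b \in trans_variant L0 w j e i
    & forall a b, a != b -> lit a b \in trans_variant L0 w j e i ->
        (lit a b \in trans_clause j e i) || w b a].
  by move/dist=> [h1 h2 h3 h4 h5]; apply: trans_variantP => //; apply: availR.
have eNjs : e \notin js by rewrite jsE (negPf eA) andbF.
(* The variable of [i] and [e] is kept for the final resolution: it enters [X], and x_{i,e} enters
   both bounds. *)
pose X := rel_or (goal_vars A) (rel_or (single i e) (single e i)).
pose hi := rel_or (goal_hi A i) (single i e).
pose lo : rel 'I_n := rel_or (fun a b => b == p a) (single i e).
have hX : forall j, j \in js -> ~~ rel_or X hi j e && ~~ rel_or X hi e j.
  move=> j /dist[ji jA pj je ej].
  rewrite /X /hi /rel_or /goal_vars /goal_hi /single /= !root_min // (negPf eA) jA.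
  by rewrite (negPf ji) (negPf je) (negPf ei) ?andbF ?(negPf ej).
have d0 : derives L (fun a b => [|| X a b, (a \in js) && (b == e) | (a == e) && (b \in js)])
    (goal_lo (e :: A) e) (fun a b => hi a b || (a \in js) && (b == e)) t1.
  apply: derives_weak d1 _ _ _ _ => // a b ab.
    rewrite /X /rel_or /single /goal_vars !inE !jsE.
    case/or3P=> [/or3P[/or3P[->|->|/andP[-> ->]]|/andP[/eqP-> ->]|/andP[-> /eqP->]]||];
      rewrite ?orbT ?iA ?orbT //.
      by case/andP=> /andP[_ ->] ->; rewrite ?orbT.
    by case/andP=> -> /andP[_ ->]; rewrite ?orbT.
  rewrite /hi /rel_or /goal_hi /single !inE jsE => /orP[/andP[/eqP be]|->].
    rewrite be in ab *; rewrite (negPf ab) eqxx /= => ->.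
    by case: (a == i); rewrite ?orbT.
  by rewrite !orbT.
case: (derives_seq (lo := lo) (C := fun j => trans_variant L0 w j e i) ujs eNjs hX d0).
- by move=> j /dist[ji jA pj je ej]; rewrite /goal_lo eqxx inE jA orbT.
- move=> j /spec[+ _ _]; rewrite !inE => /orP[->//|/(subsetP sL)->].
  by rewrite orbT.
- move=> j hj; have [_ h _] := spec j hj; have [ji jA pj je ej] := dist j hj.
  by apply: h; rewrite // in_trans // !eqxx.
- move=> j a b hj ab; have [_ _ h] := spec j hj; have [ji jA pj je ej] := dist j hj.
  move/(h _ _ ab); rewrite in_trans // /rel_or /hi /rel_or /goal_hi /single /= -!orbA.
  case/or4P => [->|->|/andP[/eqP-> ->]|->]; rewrite ?orbT //.
  by rewrite jA.
- move=> a b ab; rewrite /lo /hi /rel_or /goal_hi => /orP[/eqP bp|->]; rewrite ?orbT //.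
  by rewrite bp (forest_parent wp) ?orbT // -bp eq_sym.
- move=> a b ab; rewrite /lo /rel_or /goal_lo /single.
  by case/orP=> [->|/andP[/eqP-> ->]]; rewrite ?orbT // inE iA orbT.
move=> t [dt st nt].
have [t2 [d2 n2]] := hd2 (L :|: labels t) (setUS _ st).
exists (res i e t t2); split; last 2 first.
- by apply: subset_trans st _; apply/subsetP=> D hD; rewrite !inE hD orbT.
- rewrite /= nt; have := size_uniq_ord ujs.
  by move: (num_nodes t1) (num_nodes t2) (size js) n2 => x1 x2 x3; clear; lia.
apply: (derives_res ie _ _ _ _ dt d2).
- rewrite /rel_or /goal_vars /goal_hi /= !root_min // iA (negPf eA) (negPf ei).
  by rewrite ?andbF.
- rewrite /rel_or /goal_vars /goal_hi /= !root_min // iA (negPf eA) eqxx.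
  by rewrite ?andbF.
- by rewrite /goal_lo ri (negPf ei).
- by rewrite /goal_lo re (negPf ie) (negPf eA) andbF.
- by rewrite /lo /rel_or single_refl orbT.
- by rewrite /goal_lo eqxx inE eqxx.
- by [].
- move=> a b _; rewrite /goal_hi /rel_or /single inE => /orP[/andP[-> /orP[->|->]]|->];
  by rewrite ?orbT.
- move=> a b _; rewrite /X /rel_or /goal_vars !inE => /or3P[->|->|/andP[-> ->]];
  by rewrite ?orbT.
- by rewrite /X /rel_or single_refl ?orbT.
- by rewrite /goal_vars !inE iA eqxx ?orbT.
- by move=> a b _; rewrite /rel_or /lo /rel_or /goal_lo inE => /orP[/andP[-> ->]|->];
  rewrite ?orbT.
Qed.

(* The clauses for the heads of the proper extensions of suf have been derived. *)
Fixpoint extension_lemmas L (pr suf : seq 'I_n) : Prop :=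
  if pr is e :: pr' then
    (exists C, C \in L /\ goal_derives L (e :: suf) e (Leaf C)) /\
    extension_lemmas L pr' (e :: suf)
  else True.

Lemma extension_lemmasS L L' pr suf : L \subset L' ->
  extension_lemmas L pr suf -> extension_lemmas L' pr suf.
Proof.
move=> sL; elim: pr suf => //= e pr IH suf [[C [CL dC]] h]; split; last exact: IH.
by exists C; split; [apply: (subsetP sL) | apply: derives_weak dC _ _ _ _].
Qed.

Variable ms : seq 'I_n.
Hypotheses (ums : uniq ms) (msE : forall a, (a \in ms) = (p a == a)).

Lemma catrev_step e pr suf : catrev pr (e :: suf) = ms ->
  uniq (e :: suf) /\ forall a, a \in e :: suf -> p a = a.
Proof.
rewrite catrevE => E; split.
  by move: ums; rewrite -E cat_uniq => /and3P[].
by move=> a aA; apply/eqP; rewrite -msE -E mem_cat aA orbT.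
Qed.

(** At each extension by [e] the clause for [e] is a lemma leaf, so only the premise for [i] is
    expanded and the size is linear in the number of levels. *)
Lemma dag_chain L pr suf i : L0 \subset L -> catrev pr suf = ms -> i \in suf ->
  extension_lemmas L pr suf ->
  exists t, goal_derives L suf i t /\
            num_nodes t <= (size pr).+1 * (2 * n + 2).
Proof.
elim: pr L suf => [|e pr IH] L suf sL /=.
  move=> -> ims _; have [t [dt nt]] := dag_base ums msE ims.
  exists t; split; first exact: derives_weak dt _ _ _ _.
  by move: (num_nodes t) nt => x; clear; lia.
move=> E isuf [[C [CL dC]] hl]; have [ues rA] := catrev_step E.
case: (dag_step (K := (size pr).+1 * (2 * n + 2)) sL ues rA isuf dC).
  move=> L'; rewrite subUset => /andP[sL' _].
  apply: IH; rewrite ?inE ?isuf ?orbT //; first exact: subset_trans sL'.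
  exact: extension_lemmasS hl.
move=> t [dt _ nt]; exists t; split=> //.
apply: leq_trans nt _; rewrite /= [X in _ <= X]mulSn.
by move: (_.+1 * _) => x; clear; lia.
Qed.

(** The head clause of the longer list is built first, as the left subtree, so all later heads are
    lemmas when [dag_chain] derives the other premise. Each level costs one chain, which keeps the
    unfolding polynomial. *)
Lemma dag_diag pr i suf : catrev pr (i :: suf) = ms ->
  exists t, [/\ goal_derives L0 (i :: suf) i t,
                extension_lemmas (L0 :|: labels t) pr (i :: suf) &
                num_nodes t <= (size pr).+1 * (n.+2 * (2 * n + 2))].
Proof.
elim: pr i suf => [|e pr IH] i suf /=.
  move=> E; rewrite E.
  have ims : i \in ms by rewrite -E inE eqxx.
  have [t [dt nt]] := dag_base ums msE ims.
  by exists t; split=> //; move: (num_nodes t) nt => x; clear; nia.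
move=> E; have [ues rA] := catrev_step E.
have [t1 [d1 h1 n1]] := IH _ _ E.
have isuf : i \in i :: suf by rewrite inE eqxx.
have spr : (size pr).+1 <= n.
  have := size_uniq_ord ums; rewrite -E catrevE size_cat size_rev /=.
  by move: (size pr) (size suf) => x y; clear; lia.
case: (dag_step (K := (size pr).+1 * (2 * n + 2)) (subxx _) ues rA isuf d1).
  move=> L' sL'; apply: dag_chain => //; rewrite ?inE ?isuf ?eqxx ?orbT //.
    by apply: subset_trans sL'; rewrite subsetUl.
  exact: extension_lemmasS h1.
move=> t [dt st nt]; exists t; split=> //.
  split; last by apply: extension_lemmasS h1; apply: setUS.
  exists (label t1); split; first by rewrite inE (subsetP st) ?orbT ?label_labels.
  case: d1 => _ _ _ hlo hhi; apply: derives_leaf => //.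
  by rewrite !inE (subsetP st) ?orbT ?label_labels.
apply: leq_trans nt _; rewrite [X in _ <= X]mulSn addnC.
apply: leq_add n1; move: (size pr) spr => x hx; clear -hx; nia.
Qed.

End Dag.

(** The bound of [dag_diag] with [size pr] replaced by [n]. *)
Definition dag_size := n.+1 * (n.+2 * (2 * n + 2)).

Definition falsified w : rel 'I_n := fun i j => w j i.
Definition assigned w : rel 'I_n := fun i j => w i j || w j i.
(** For non-minimal [i] this is x_{i,p i}, the negation of x_{p i,i}. A minimal [i] gives the pair
    (i,i), which is no literal. *)
Definition upto (p : 'I_n -> 'I_n) : rel 'I_n := fun i j => j == p i.

Lemma dag_refutation L w p : 0 < n -> forest w p ->
  (forall a b c, p a = a -> p b = b -> p c = c ->
     a != b -> b != c -> a != c -> available L w a b c) ->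
  (forall j i, p j != j -> p i = i -> i != p j -> available L w (p j) j i) ->
  exists t, derives L (assigned w) (upto p) (falsified w) t /\
            num_nodes t <= dag_size.
Proof.
move=> n0 wp hR hP.
pose ms := [seq i <- enum 'I_n | p i == i].
have msE a : (a \in ms) = (p a == a) by rewrite mem_filter mem_enum inE andbT.
have ums : uniq ms by rewrite filter_uniq ?enum_uniq.
(* By idempotence every value of [p] is minimal, so a minimal element exists. *)
have : p (Ordinal n0) \in ms by rewrite msE (forest_idem wp).
case/lastP E : ms => [//|pr i] _; move: msE ums; rewrite E => msE ums.
have Em : catrev (rev pr) [:: i] = rcons pr i by rewrite catrevE revK cats1.
have [t [dt _ nt]] := dag_diag wp hR hP ums msE Em.
exists t; split.
  apply: derives_weak dt _ _ _ _ => // a b ab.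
  - by rewrite /goal_vars /assigned => /orP[->|->]; rewrite ?orbT.
  - by rewrite /goal_lo /upto => ->; rewrite orbT.
  (* With one element left in [A], the positive part would be x_{i,i}; only falsified literals
     remain. *)
  - rewrite /goal_hi inE => /orP[/andP[/eqP bi /eqP ai]|//].
    by rewrite ai bi eqxx in ab.
apply: leq_trans nt _; rewrite leq_mul2r; apply/orP; right.
have := size_uniq_ord ums; by rewrite size_rcons size_rev => /leqW.
Qed.

End Guards.

(** * Branching with learning, and the amortized node count *)

Section Search.
Variables (n : nat) (v0 : gvar n) (r s : 'I_n -> 'I_n -> 'I_n -> 'I_n).
Hypothesis rs : guard_functions r s.
Implicit Types (i j a b c k x y : 'I_n) (L Q : {set clause (gvar n)}).
Implicit Types (w lo E : rel 'I_n) (R : pred 'I_n) (B : nat) (ks : seq 'I_n).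
Local Notation lit := (lit v0).
Local Notation res := (res v0).
Local Notation F := (GGT r s).
Local Notation derives := (derives v0 F).
Local Notation guard_set := (guard_set r s).
Local Notation dag_size := (dag_size n).

Definition trans_clauses : {set clause (gvar n)} :=
  [set trans_clause x.1.1 x.1.2 x.2 | x : 'I_n * 'I_n * 'I_n].

Definition unlearned L := #|trans_clauses :\: L|.

(** The cost of the largest stage: three side branches of [dag_size + 4 * n] nodes, three nodes that
    learn the clause, and three resolutions. *)
Definition weight := 3 * dag_size + 12 * n + 6.

(* Learning one transitivity clause pays for weight nodes. *)
Definition solvable B Q L w lo : Prop := exists t,
  [/\ derives L (assigned w) lo (falsified w) t, Q \subset labels t &
      num_nodes t + weight * unlearned (L :|: labels t) <= B].

Lemma unlearnedS L L' : L \subset L' -> unlearned L' <= unlearned L.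
Proof. by move=> sL; apply/subset_leq_card/setDS. Qed.

Lemma unlearned_lt L L' a b c : L \subset L' -> trans_clause a b c \notin L ->
  trans_clause a b c \in L' -> unlearned L' < unlearned L.
Proof.
move=> sL TL TL'; apply/proper_card/properP; split; first exact: setDS.
exists (trans_clause a b c); rewrite inE ?TL' // TL.
by apply/imsetP; exists (a, b, c).
Qed.

Lemma solvable_weak B B' Q L w w' lo lo' : solvable B Q L w lo -> B <= B' ->
  (forall i j, i != j -> w' i j = w i j) ->
  (forall i j, i != j -> lo' i j -> lo i j) -> solvable B' Q L w' lo'.
Proof.
move=> [t [dt Qt nt]] hB hw hlo; exists t; split=> //; last exact: leq_trans hB.
apply: derives_weak dt _ _ hlo _ => // i j ij; have ji : j != i by rewrite eq_sym.
  by rewrite /assigned !hw.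
by rewrite /falsified hw.
Qed.

(** The left subtree comes first in the postorder: what it learns, [Q] included, is available on the
    right, and the weight of the clauses still unlearned is passed on to pay for the right
    subtree. *)
Lemma solvable_res B1 B2 Q L w lo lo1 lo2 a b : a != b ->
  ~~ w a b -> ~~ w b a -> ~~ lo a b -> ~~ lo b a ->
  solvable B1 Q L (rel_or w (single b a)) lo1 -> lo1 a b ->
  (forall L', L \subset L' -> Q \subset L' ->
     solvable (B2 + weight * unlearned L') set0 L' (rel_or w (single a b)) lo2) ->
  lo2 b a ->
  (forall i j, i != j -> lo i j -> lo1 i j || lo2 i j) ->
  solvable (B1 + B2 + 1) Q L w lo.
Proof.
move=> ab wab wba loab loba [t1 [d1 Q1 n1]] lo1ab h2 lo2ba hlo.
have [|t2 [d2 _ n2]] := h2 _ (subsetUl L (labels t1)).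
  by apply: subset_trans Q1 _; rewrite subsetUr.
exists (res a b t1 t2); split.
- have hX : ~~ rel_or (assigned w) (falsified w) a b.
    by rewrite /rel_or /assigned /falsified (negPf wab) (negPf wba).
  have hX' : ~~ rel_or (assigned w) (falsified w) b a.
    by rewrite /rel_or /assigned /falsified (negPf wab) (negPf wba).
  apply: (derives_res ab hX hX' loab loba d1 d2) => //.
  + by move=> i j _; rewrite /falsified /rel_or /single (andbC (i == a)).
  + by move=> i j _; rewrite /falsified /rel_or /single (andbC (i == b)).
  + by move=> i j _; rewrite /assigned /rel_or => /orP[->|->]; rewrite ?orbT.
  + by rewrite /assigned /rel_or single_refl !orbT.
  + by rewrite /assigned /rel_or single_refl !orbT.
- by apply: subset_trans Q1 _; apply/subsetP=> D hD; rewrite !inE hD orbT.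
have sl : L :|: labels t1 :|: labels t2 \subset L :|: labels (res a b t1 t2).
  by rewrite -setUA setUS // subsetUr.
have := unlearnedS sl; move: n1 n2 => /=.
move: (unlearned _) (unlearned _) (unlearned _) weight => x1 x2 x3 W.
by move: (num_nodes t1) (num_nodes t2) => y1 y2; clear; nia.
Qed.

Definition trans_rel a b c : rel 'I_n := fun i j =>
  [|| (i == b) && (j == a), (i == c) && (j == b) | (i == a) && (j == c)].

Lemma guard_outside a b c : a != b -> b != c -> a != c ->
  ~~ ((r a b c \in [:: a; b; c]) && (s a b c \in [:: a; b; c])).
Proof.
move=> ab bc ac; have [_ h _ _] := rs ab bc ac.
apply: contra h => /andP[h1 h2]; apply/subsetP=> x; rewrite !inE.
by move: h1 h2; rewrite !inE => h1 h2 /orP[]/eqP->; rewrite -orbA.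
Qed.

(** The guard pair is not contained in {a,b,c}, so comparisons among these three cannot set the
    guard variable. *)
Lemma guard_set_extend w w' a b c : a != b -> b != c -> a != c ->
  (forall i j, w' i j -> w i j || (i \in [:: a; b; c]) && (j \in [:: a; b; c])) ->
  ~~ guard_set w a b c -> ~~ guard_set w' a b c.
Proof.
move=> ab bc ac hw; have := guard_outside ab bc ac.
rewrite /guard_set => go; apply: contra.
case/orP=> /hw /orP[->|h]; rewrite ?orbT //; first by rewrite h in go.
by rewrite andbC h in go.
Qed.

(** As the guard variable is unset, resolving the two guarded versions on it stays regular. This
    takes three nodes and makes T_{a,b,c} a lemma. *)
Lemma close_learn L w a b c : a != b -> b != c -> a != c ->
  w a b -> w b c -> w c a -> trans_clause a b c \notin L -> ~~ guard_set w a b c ->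
  solvable (3 + weight * (unlearned L).-1) [set trans_clause a b c] L w
    (trans_rel a b c).
Proof.
move=> ab bc ac wab wbc wca TL ng.
have [gh _ _ _] := rs ab bc ac; have /andP[FT1 FT2] := guarded_in_GGT r s ab bc ac.
have go := guard_outside ab bc ac; move: ng; rewrite /guard_set.
move: gh FT1 FT2 go; set g := r a b c; set h := s a b c => gh FT1 FT2 go ng.
set T := trans_clause a b c in FT1 FT2 TL *.
have Tlt L' : L \subset L' -> T \in L' -> unlearned L' < unlearned L.
  by move=> sL; apply: unlearned_lt.
have inT i j : i != j -> (lit i j \in T) = trans_rel a b c i j.
  by move=> ij; rewrite in_trans.
clearbody T; have hg : h != g by rewrite eq_sym.
pose t := res g h (Leaf (T :|: unit_clause g h)) (Leaf (T :|: unit_clause h g)).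
have Tgh : ~~ trans_rel a b c g h.
  apply: contra go; rewrite /trans_rel !inE.
  by case/or3P=> /andP[-> ->]; rewrite ?orbT.
have Thg : ~~ trans_rel a b c h g.
  apply: contra go; rewrite /trans_rel !inE.
  by case/or3P=> /andP[-> ->]; rewrite ?orbT.
have Tfalse i j : trans_rel a b c i j -> falsified w i j.
  by rewrite /falsified; case/or3P=> /andP[/eqP-> /eqP->].
have leaf x y : x != y -> T :|: unit_clause x y \in F -> forall L' X,
    derives L' X (rel_or (trans_rel a b c) (single x y))
      (rel_or (falsified w) (single x y)) (Leaf (T :|: unit_clause x y)).
  move=> xy FT L' X; apply: derives_leaf => [|i j ij|i j ij].
  - by rewrite inE FT.
  - by rewrite in_setU inT // in_unit.
  - rewrite in_setU inT // in_unit // /rel_or => /orP[/Tfalse->//|].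
    by rewrite /single => ->; rewrite orbT.
(* The bounds of [derives] leave the label open; to count as learned it must be exactly [T]. *)
have labt : label t = T.
  apply: (@clause_ext _ v0) => i j ij; rewrite in_res // /= !in_setU !in_unit //.
  rewrite inT //.
  case: (boolP ((i == g) && (j == h))) => [/andP[/eqP-> /eqP->]|_] /=.
    by rewrite (negPf gh) (negPf Tgh) /= ?andbF.
  case: (boolP ((i == h) && (j == g))) => [/andP[/eqP-> /eqP->]|_] /=.
    by rewrite (negPf Thg).
  by rewrite !orbF orbb.
have Tt : T \in labels t by rewrite -labt label_labels.
exists t; split; last 1 first.
- apply: leq_add => //; rewrite leq_mul2l -ltnS; apply/orP; right.
  have Tu : T \in L :|: labels t by rewrite inE Tt orbT.
  have := Tlt _ (subsetUl _ _) Tu.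
  by move: (unlearned _) (unlearned _) => u1 u2; clear; lia.
- have hX : ~~ rel_or (assigned w) (falsified w) g h.
    by rewrite /rel_or /assigned /falsified; move: ng; case: (w g h); case: (w h g).
  have hX' : ~~ rel_or (assigned w) (falsified w) h g.
    by rewrite /rel_or /assigned /falsified; move: ng; case: (w g h); case: (w h g).
  apply: (derives_res gh hX hX' Tgh Thg
            (leaf g h gh FT1 L (fun _ _ => true))
            (leaf h g hg FT2 _ (fun _ _ => true))) => //.
  + by rewrite /rel_or single_refl orbT.
  + by rewrite /rel_or single_refl orbT.
  + by move=> i j _; rewrite /rel_or => ->.
- by rewrite sub1set.
Qed.

(** One leaf suffices if a version of the clause is available; otherwise [close_learn] applies. *)
Lemma close L w a b c : a != b -> b != c -> a != c -> w a b -> w b c -> w c a ->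
  solvable (3 + weight * unlearned L) set0 L w (trans_rel a b c).
Proof.
move=> ab bc ac wab wbc wca.
case: (boolP (available r s L w a b c)) => [av|]; last first.
  rewrite /available negb_or => /andP[TL ng].
  have [t [dt _ nt]] := close_learn ab bc ac wab wbc wca TL ng.
  exists t; split; rewrite ?sub0set //; apply: leq_trans nt _.
  by rewrite leq_add2l leq_mul2l leq_pred orbT.
have [h1 h2 h3] := trans_variantP v0 ab bc ac av.
exists (Leaf (trans_variant r s L w a b c)); split; rewrite ?sub0set //.
  apply: derives_leaf => [//|i j ij hij|i j ij /(h3 _ _ ij)].
    by apply: h2 => //; rewrite in_trans.
  rewrite in_trans // /falsified => /orP[|//].
  by case/or3P=> /andP[/eqP-> /eqP->].
rewrite leq_add // leq_mul2l; apply/orP; right.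
by apply: unlearnedS; rewrite subsetUl.
Qed.

(** * Moving the children of former minimal elements below a minimal element *)

Section Attach.
Variables (w : rel 'I_n) (p : 'I_n -> 'I_n) (y : 'I_n) (R : pred 'I_n) (E : rel 'I_n).
Hypotheses (wp : forest w p) (rootR : forall x, R x -> p x = x).
Hypotheses (rooty : p y = y) (Ry : ~~ R y).
Hypothesis ER : forall i j, E i j -> R i && R j.
Hypothesis Eanti : forall i j, E i j -> ~~ E j i.

Definition attach_parent k := if R (p k) then y else p k.

(* The children of the roots in R are moved below the root y, except for those in
   ks; E lists further comparisons within R. *)
Definition attach ks : rel 'I_n := fun i j =>
  [|| w i j, [&& i == y, R (p j) & j \notin ks] | E i j].

Definition attach_lo ks : rel 'I_n :=
  fun i j => j == (if i \in ks then p i else attach_parent i).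

Let wroot i j : p j = j -> w i j = false := @root_min _ _ _ wp i j.

Let Ey i : E i y = false.
Proof. by apply/negP=> /ER/andP[_]; rewrite (negPf Ry). Qed.

Let yE i : E y i = false.
Proof. by apply/negP=> /ER/andP[]; rewrite (negPf Ry). Qed.

(** The elements of [R] cease to be minimal, so [y] is the only minimal predecessor both of them and
    of their former children. *)
Lemma attach_forest : forest (attach [::]) attach_parent.
Proof.
rewrite /attach /attach_parent; split.
- move=> i j; case/or3P => [wij|/and3P[/eqP-> Rj _]|Eij].
  + rewrite !negb_or (forest_anti wp wij) /=; apply/andP; split.
      by apply: contraL wij => /and3P[/eqP-> _ _]; rewrite wroot.
    apply: contraL wij => /ER/andP[Rj Ri].
    by rewrite wroot // rootR.
  + by rewrite wroot // Ey rooty (negPf Ry) andbF.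
  + have /andP[Ri Rj] := ER Eij; rewrite wroot ?rootR // (negPf (Eanti Eij)).
    rewrite orbF /= andbT; apply/negP=> /andP[/eqP jy _].
    by rewrite jy (negPf Ry) in Rj.
- move=> i j; case/or3P => [wij|/and3P[_ Rj _]|Eij].
  + case: ifP => _; last exact: (forest_root wp wij).
    by apply: contraTneq wij => <-; rewrite wroot.
  + rewrite Rj; apply: contraTneq Rj => <-; by rewrite rooty.
  + have /andP[_ Rj] := ER Eij; rewrite rootR // Rj.
    by apply: contraTneq Rj => <-.
- move=> i; case: ifP => [Ri yi|_ h]; first by rewrite eqxx orbT.
  by rewrite (forest_parent wp h).
- move=> m k; case: ifP => [Rm my|Rm pm].
    by move: Rm; rewrite -my rooty (negPf Ry).
  case/or3P => [wmk|/and3P[/eqP-> -> _ //]|/ER/andP[Rm']].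
    by rewrite (forest_uniq wp pm wmk) -{1}pm Rm.
  by move: Rm; rewrite rootR // Rm'.
- move=> i; case Ri: (R (p i)); first by rewrite rooty (negPf Ry).
  by rewrite (forest_idem wp) Ri.
Qed.

(** Branch on [k] against [y]. With [k] below [y] there is a cycle p k < k < y < p k, so T_{p k,k,y}
    is false. Resolving with it replaces x_{k,y} from the other branch by x_{k,p k}, which restores
    the invariant for the old parent. *)
Lemma attach_step B1 B2 Q L k ks : k \notin ks ->
  (forall z, z \in k :: ks -> R (p z) && ~~ R z) ->
  solvable B1 Q L (rel_or (attach (k :: ks)) (single k y)) (trans_rel (p k) k y) ->
  (forall L', L \subset L' -> Q \subset L' ->
     solvable (B2 + weight * unlearned L') set0 L' (attach ks) (attach_lo ks)) ->
  solvable (B1 + B2 + 1) Q L (attach (k :: ks)) (attach_lo (k :: ks)).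
Proof.
move=> kks hks h1 h2; have /andP[Rk nRk] := hks k (mem_head _ _).
have yk : y != k by apply: contraTneq Rk => <-; rewrite rooty.
have ky : k != y by rewrite eq_sym.
have pky : p k != y by apply: contraTneq Rk => ->.
have yks : y \notin k :: ks by apply/negP => /hks; rewrite rooty (negPf Ry).
have wyk : w y k = false.
  by apply: contraNF pky => /(forest_uniq wp rooty) ->.
have nE z : E z k = false /\ E k z = false.
  by split; apply/negP => /ER/andP[h h']; move: nRk; rewrite ?h ?h'.
have [Eyk Eky] := nE y.
apply: (solvable_res (lo2 := attach_lo ks) yk _ _ _ _ h1).
- by rewrite /attach wyk mem_head Eyk !andbF.
- by rewrite /attach wroot // (negPf ky) Eky.
- rewrite /attach_lo (negPf yks) /attach_parent rooty (negPf Ry).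
  exact: ky.
- by rewrite /attach_lo inE eqxx /= eq_sym.
- by rewrite /trans_rel !eqxx orbT.
- move=> L' sL QL; apply: solvable_weak (h2 L' sL QL) _ _ _ => // i j _.
  rewrite /rel_or /attach /single inE; case: eqP => //= _; rewrite ?orbF //.
  case: (j =P k) => [->|_] /=; last by rewrite orbF.
  by rewrite Rk kks andbF !orbT.
- by rewrite /attach_lo (negPf kks) /attach_parent Rk.
- move=> i j ij; rewrite /attach_lo inE; case: (i =P k) => [->|_] /=.
    by rewrite /trans_rel eqxx => ->.
  by move->; rewrite orbT.
Qed.

Lemma attach_cycle k ks : k \notin ks ->
  (forall z, z \in k :: ks -> R (p z) && ~~ R z) ->
  [/\ p k != k, k != y, p k != y,
      w (p k) k & rel_or (attach (k :: ks)) (single k y) y (p k)].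
Proof.
move=> kks hks; have /andP[Rk nRk] := hks k (mem_head _ _).
have pk : p k != k by apply: contraTneq Rk => ->.
split=> //.
- by apply: contraTneq Rk => ->; rewrite rooty.
- by apply: contraTneq Rk => ->.
- exact: (forest_parent wp).
- rewrite /rel_or /attach eqxx (forest_idem wp) Rk /=.
  suff -> : p k \notin k :: ks by rewrite orbT.
  by apply/negP=> /hks; rewrite Rk andbF.
Qed.

(** Each child costs at most three nodes for [close] and one resolution. *)
Lemma attach_seq B L ks : uniq ks ->
  (forall z, z \in ks -> R (p z) && ~~ R z) ->
  (forall L', L \subset L' ->
     solvable (B + weight * unlearned L') set0 L' (attach [::]) (upto attach_parent)) ->
  solvable (B + 4 * size ks + weight * unlearned L) set0 L (attach ks) (attach_lo ks).
Proof.
elim: ks L => [|k ks IH] L /=.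
  by move=> _ _ h; rewrite muln0 addn0; apply: h.
move=> /andP[kks uks] hks h.
have hks' z : z \in ks -> R (p z) && ~~ R z by move=> zks; apply: hks; rewrite inE zks orbT.
have [c1 c2 c3 c4 c5] := attach_cycle kks hks.
have cl : solvable (3 + weight * unlearned L) set0 L
    (rel_or (attach (k :: ks)) (single k y)) (trans_rel (p k) k y).
  apply: close => //; first by rewrite /rel_or /attach c4.
  by rewrite /rel_or single_refl orbT.
apply: solvable_weak (attach_step (B2 := B + 4 * size ks) kks hks cl _) _ _ _ => //.
  move=> L' sL _; apply: IH => // L'' sL'; apply: h.
  exact: subset_trans sL'.
by move: (weight * _) => x; clear; lia.
Qed.

Let children := [seq k <- enum 'I_n | R (p k) && ~~ R k].

Definition attach_start : rel 'I_n := fun i j => [|| w i j, (i == y) && R j | E i j].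
Definition attach_start_lo : rel 'I_n := fun i j => R i && (j == y) || (j == p i).

(** Right after the branching [y] is below [R] but no child has been moved, so [ks] holds them
    all. *)
Lemma attach_start_weak B Q L ks :
  (forall k, (k \in ks) = R (p k) && ~~ R k) ->
  solvable B Q L (attach ks) (attach_lo ks) ->
  solvable B Q L attach_start attach_start_lo.
Proof.
move=> ksE h; apply: solvable_weak h _ _ _ => // i j ij.
  rewrite /attach_start /attach ksE; congr [|| _, _ && _ | _].
  case: (boolP (R j)) => [Rj|]; first by rewrite rootR // Rj.
  by case: (R (p j)).
rewrite /attach_start_lo /attach_lo ksE /attach_parent.
case: (boolP (R i)) => [Ri|nRi] /=.
  rewrite rootR // Ri /= => /orP[//|/eqP ji].
  by rewrite ji eqxx in ij.
by case: (R (p i)).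
Qed.

Lemma attach_solvable B L :
  (forall L', L \subset L' ->
     solvable (B + weight * unlearned L') set0 L' (attach [::]) (upto attach_parent)) ->
  solvable (B + 4 * n + weight * unlearned L) set0 L attach_start attach_start_lo.
Proof.
move=> h; have uks : uniq children by rewrite filter_uniq ?enum_uniq.
have ksE k : (k \in children) = R (p k) && ~~ R k.
  by rewrite mem_filter mem_enum inE andbT.
apply: (attach_start_weak ksE).
apply: solvable_weak (attach_seq (B := B) (L := L) uks _ h) _ _ _ => //.
  by move=> z; rewrite ksE.
by rewrite leq_add2r leq_add2l leq_mul2l size_uniq_ord.
Qed.

(** Moving the child [j] before all others makes T_{p j,j,y} the first clause derived, hence a lemma
    for everything after it. *)
Lemma attach_learn B L j : R (p j) -> ~~ R j ->
  trans_clause (p j) j y \notin L ->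
  (forall i k, E i k = false) -> (forall x, R x -> x = p j) ->
  ~~ guard_set w (p j) j y ->
  (forall L', L \subset L' -> trans_clause (p j) j y \in L' ->
     solvable (B + weight * unlearned L') set0 L' (attach [::]) (upto attach_parent)) ->
  solvable (B + 4 * n + weight * (unlearned L).-1) [set trans_clause (p j) j y] L
    attach_start attach_start_lo.
Proof.
move=> Rj nRj TL E0 R1 ng h.
pose ks := rem j children.
have uc : uniq children by rewrite filter_uniq ?enum_uniq.
have cE k : (k \in children) = R (p k) && ~~ R k.
  by rewrite mem_filter mem_enum inE andbT.
have jc : j \in children by rewrite cE Rj.
have jks : j \notin ks by rewrite mem_rem_uniq // !inE eqxx.
have uks : uniq ks by rewrite rem_uniq.
have ksE k : (k \in j :: ks) = R (p k) && ~~ R k.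
  rewrite inE mem_rem_uniq // !inE cE; case: eqP => [->|//].
  by rewrite Rj nRj.
have hks z : z \in j :: ks -> R (p z) && ~~ R z by rewrite ksE.
have sks : (size ks).+1 <= n.
  by rewrite -[_.+1]/(size (j :: ks)) size_uniq_ord //= jks.
apply: (attach_start_weak ksE).
have [c1 c2 c3 c4 c5] := attach_cycle jks hks.
have cl : solvable (3 + weight * (unlearned L).-1) [set trans_clause (p j) j y] L
    (rel_or (attach (j :: ks)) (single j y)) (trans_rel (p j) j y).
  apply: close_learn => //; first by rewrite /rel_or /attach c4.
    by rewrite /rel_or single_refl orbT.
  (* The only comparisons added are [y] below [p j] and [j] below [y], both inside the triple. *)
  apply: guard_set_extend ng => // i k; rewrite /rel_or /attach /single E0 orbF.
  case/orP=> [/orP[->//|/and3P[/eqP-> Rk]]|/andP[/eqP-> /eqP->]]; last first.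
    by rewrite !inE !eqxx !orbT.
  rewrite ksE Rk /= negbK => /R1->.
  by rewrite !inE !eqxx !orbT.
apply: solvable_weak (attach_step (B2 := B + 4 * size ks) jks hks cl _) _ _ _ => //.
  move=> L' sL; rewrite sub1set => TL'; apply: attach_seq => //.
    by move=> z zks; apply: hks; rewrite inE zks orbT.
  move=> L'' sL'; apply: h; first exact: subset_trans sL'.
  exact: (subsetP sL').
by move: (weight * _) (size ks) sks => x z; clear; lia.
Qed.

End Attach.

(** * One stage: learning a missing transitivity clause *)

Section Stage.
Variables (L : {set clause (gvar n)}) (T : clause (gvar n)).
Hypothesis solveT : forall L' w' p', L \subset L' -> T \in L' -> forest w' p' ->
  solvable (dag_size + weight * unlearned L') set0 L' w' (upto p').
Variables (w : rel 'I_n) (p : 'I_n -> 'I_n).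
Hypothesis wp : forest w p.

Let wroot i j : p j = j -> w i j = false := @root_min _ _ _ wp i j.

Lemma solve_attach L' y R E : L \subset L' -> [set T] \subset L' ->
  (forall x, R x -> p x = x) -> p y = y -> ~~ R y ->
  (forall i j, E i j -> R i && R j) -> (forall i j, E i j -> ~~ E j i) ->
  solvable (dag_size + 4 * n + weight * unlearned L') set0 L'
    (attach_start w y R E) (attach_start_lo p y R).
Proof.
move=> sL; rewrite sub1set => TL' rootR rooty Ry ER Eanti.
apply: attach_solvable => // L'' sL'; apply: solveT.
- exact: subset_trans sL'.
- exact: (subsetP sL').
- exact: attach_forest.
Qed.

Lemma stage_bound : trans_clauses :\: L != set0 ->
  3 + weight * (unlearned L).-1 + (dag_size + 4 * n) + 1 + (dag_size + 4 * n) + 1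
    + (dag_size + 4 * n) + 1 <= dag_size + weight * unlearned L.
Proof.
rewrite -card_gt0 /unlearned; move: #|_| => [//|u] _.
rewrite succnK mulnS; move: (weight * u) => x.
by rewrite /weight; move: dag_size => y; clear; lia.
Qed.

(** The leftmost path sets a < b, c < a, b < c and learns T_{a,b,c} at its end. Each departure from
    it leaves one of the three minimal with the newly non-minimal ones below it in the forest. *)
Lemma solve_roots a b c : p a = a -> p b = b -> p c = c ->
  a != b -> b != c -> a != c -> T = trans_clause a b c -> T \notin L ->
  ~~ guard_set w a b c -> solvable (dag_size + weight * unlearned L) set0 L w (upto p).
Proof.
move=> pa pb pc ab bc ac ET TL ng.
have ba : b != a by rewrite eq_sym.
have cb : c != b by rewrite eq_sym.
have ca : c != a by rewrite eq_sym.
pose w1 := rel_or w (single a b); pose w2 := rel_or w1 (single c a).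
have c1 : solvable (3 + weight * (unlearned L).-1) [set T] L
    (rel_or w2 (single b c)) (trans_rel a b c).
  rewrite ET; apply: close_learn => //; rewrite -?ET //.
  - by rewrite /w2 /w1 /rel_or single_refl ?orbT.
  - by rewrite /rel_or single_refl ?orbT.
  - by rewrite /w2 /w1 /rel_or single_refl ?orbT.
  apply: guard_set_extend ng => // i j; rewrite /w2 /w1 /rel_or /single.
  rewrite -!orbA => /or4P[->//|||] /andP[/eqP-> /eqP->];
  by rewrite !inE !eqxx ?orbT.
(* Side branch c < b: both [a] and [b] are attached to [c], with a < b as the extra comparison. *)
have c2 : solvable (3 + weight * (unlearned L).-1 + (dag_size + 4 * n) + 1) [set T] L
    w2 (rel_or (upto p) (rel_or (single b a) (single a c))).
  have wE u v : p v = v -> w2 u v = ((u == a) && (v == b)) || ((u == c) && (v == a)).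
    by move=> pv; rewrite /w2 /w1 /rel_or wroot.
  apply: (solvable_res (lo2 := attach_start_lo p c (pred2 a b)) cb _ _ _ _ c1).
  - by rewrite wE // (negPf ca) (negPf ba) andbF.
  - by rewrite wE // (negPf ba) (negPf bc).
  - by rewrite /rel_or /upto /single pc (negPf bc) (negPf cb) (negPf ca).
  - by rewrite /rel_or /upto /single pb (negPf cb) (negPf ca) (negPf ba) /= andbF.
  - by rewrite /trans_rel !eqxx ?orbT.
  - move=> L' sL TL'; apply: solvable_weak
      (solve_attach (y := c) (R := pred2 a b) (E := single a b) sL TL' _ _ _ _ _) _ _ _ => //.
    + by move=> x /orP[]/eqP->.
    + by rewrite /= negb_or ca.
    + by move=> i j /andP[/eqP-> /eqP->]; rewrite /= !eqxx orbT.
    + by move=> i j /andP[/eqP-> /eqP->]; rewrite /single (negPf ba).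
    + move=> i j _; rewrite /w2 /w1 /attach_start /rel_or /single /=.
      by case: (w i j); case: (i == a); case: (i == c); case: (j == b); case: (j == a).
  - by rewrite /attach_start_lo /= !eqxx orbT.
  - move=> i j _; rewrite /rel_or /upto /single /attach_start_lo /trans_rel /=.
    case/or3P=> [->|/andP[-> ->]|/andP[-> ->]]; by rewrite ?orbT.
(* Side branch a < c: both [b] and [c] are attached to [a]. *)
have c3 : solvable (3 + weight * (unlearned L).-1 + (dag_size + 4 * n) + 1
    + (dag_size + 4 * n) + 1) [set T] L w1 (rel_or (upto p) (single b a)).
  have wE u v : p v = v -> w1 u v = (u == a) && (v == b).
    by move=> pv; rewrite /w1 /rel_or wroot.
  apply: (solvable_res (lo2 := attach_start_lo p a (pred2 b c)) ac _ _ _ _ c2).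
  - by rewrite wE // (negPf cb) andbF.
  - by rewrite wE // (negPf ca).
  - by rewrite /rel_or /upto /single pa (negPf ca) (negPf ab).
  - by rewrite /rel_or /upto /single pc (negPf ac) (negPf cb).
  - by rewrite /rel_or single_refl !orbT.
  - move=> L' sL TL'; apply: solvable_weak
      (solve_attach (y := a) (R := pred2 b c) (E := fun _ _ => false) sL TL' _ _ _ _ _) _ _ _ => //.
    + by move=> x /orP[]/eqP->.
    + by rewrite /= negb_or ab.
    + move=> i j _; rewrite /w1 /attach_start /rel_or /single /=.
      by case: (w i j); case: (i == a); case: (j == b); case: (j == c).
  - by rewrite /attach_start_lo /= !eqxx orbT.
  - by move=> i j _; rewrite /rel_or => /orP[->|->]; rewrite ?orbT.
(* Side branch b < a: only [a] is attached, to [b], and [c] stays minimal. *)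
have c4 : solvable (3 + weight * (unlearned L).-1 + (dag_size + 4 * n) + 1
    + (dag_size + 4 * n) + 1 + (dag_size + 4 * n) + 1) [set T] L w (upto p).
  apply: (solvable_res (lo2 := attach_start_lo p b (pred1 a)) ba _ _ _ _ c3).
  - by rewrite wroot.
  - by rewrite wroot.
  - by rewrite /upto pb.
  - by rewrite /upto pa.
  - by rewrite /rel_or single_refl orbT.
  - move=> L' sL TL'; apply: solvable_weak
      (solve_attach (y := b) (R := pred1 a) (E := fun _ _ => false) sL TL' _ _ _ _ _) _ _ _ => //.
    + by move=> x /eqP->.
    + by move=> i j _; rewrite /attach_start /rel_or /single /= orbF.
  - by rewrite /attach_start_lo /= !eqxx.
  - by move=> i j _; rewrite /rel_or => ->.
have [t [dt Qt nt]] := c4.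
exists t; split; rewrite ?sub0set //; apply: leq_trans nt (stage_bound _).
apply/set0Pn; exists T; rewrite inE TL ET.
by apply/imsetP; exists (a, b, c).
Qed.

(** Branch on [p j] against [y]. If y < p j, then [p j] is attached to [y], and moving its child [j]
    learns the clause; otherwise [y] is attached to [p j]. *)
Lemma solve_parent j y : p j != j -> p y = y -> y != p j ->
  T = trans_clause (p j) j y -> T \notin L -> ~~ guard_set w (p j) j y ->
  solvable (dag_size + weight * unlearned L) set0 L w (upto p).
Proof.
move=> pj py ypj ET TL ng.
have ppj := forest_idem wp j.
have pjy : p j != y by rewrite eq_sym.
have c1 : solvable (dag_size + 4 * n + weight * (unlearned L).-1) [set T] L
    (attach_start w y (pred1 (p j)) (fun _ _ => false))
    (attach_start_lo p y (pred1 (p j))).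
  rewrite ET; apply: attach_learn => //=; rewrite -?ET //.
  - by move=> x /eqP->.
  - by rewrite eq_sym.
  - by move=> x /eqP.
  move=> L' sL TL'; apply: solveT => //; apply: attach_forest => //.
  by move=> x /eqP->.
have c1' : solvable (dag_size + 4 * n + weight * (unlearned L).-1) [set T] L
    (rel_or w (single y (p j))) (attach_start_lo p y (pred1 (p j))).
  by apply: solvable_weak c1 _ _ _ => // i k _; rewrite /attach_start orbF.
have c2 : solvable (dag_size + 4 * n + weight * (unlearned L).-1
    + (dag_size + 4 * n) + 1) [set T] L w (upto p).
  apply: (solvable_res (lo2 := attach_start_lo p (p j) (pred1 y)) pjy _ _ _ _ c1').
  - by rewrite wroot.
  - by rewrite wroot.
  - by rewrite /upto ppj.
  - by rewrite /upto py.
  - by rewrite /attach_start_lo /= !eqxx.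
  - move=> L' sL TL'; apply: solvable_weak
      (solve_attach (y := p j) (R := pred1 y) (E := fun _ _ => false) sL TL' _ _ _ _ _) _ _ _ => //.
    + by move=> x /eqP->.
    + by move=> i k _; rewrite /attach_start orbF.
  - by rewrite /attach_start_lo /= !eqxx.
  - by move=> i k _; rewrite /upto /attach_start_lo => ->; rewrite orbT.
have [t [dt Qt nt]] := c2.
exists t; split; rewrite ?sub0set //.
have nT : trans_clauses :\: L != set0.
  apply/set0Pn; exists T; rewrite inE TL ET.
  by apply/imsetP; exists (p j, j, y).
apply: leq_trans nt _; apply: leq_trans (stage_bound nT).
by move: (weight * _) => x; clear; lia.
Qed.

End Stage.

(** * Induction on the number of unlearned clauses, and the polynomial bound *)

Lemma solve L w p : 0 < n -> forest w p ->
  solvable (dag_size + weight * unlearned L) set0 L w (upto p).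
Proof.
move=> n0; have [v] := ubnP (unlearned L).
(* Every recursive call of a stage has the clause of that stage among its lemmas, so the unlearned
   count strictly decreases. *)
elim: v L w p => // v IH L w p uL wp.
have solveT T : T \in trans_clauses -> T \notin L -> forall L' w' p',
    L \subset L' -> T \in L' -> forest w' p' ->
    solvable (dag_size + weight * unlearned L') set0 L' w' (upto p').
  case/imsetP=> x _ -> TL L' w' p' sL TL'; apply: IH.
  exact: leq_trans (unlearned_lt sL TL TL') uL.
have inT a b c : trans_clause a b c \in trans_clauses.
  by apply/imsetP; exists (a, b, c).
case: (boolP [exists x : 'I_n * 'I_n * 'I_n,
    [&& p x.1.1 == x.1.1, p x.1.2 == x.1.2, p x.2 == x.2,
        x.1.1 != x.1.2, x.1.2 != x.2, x.1.1 != x.2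
      & ~~ available r s L w x.1.1 x.1.2 x.2]]).
  case/existsP=> -[[a b] c] /= /and5P[/eqP pa /eqP pb /eqP pc ab /and3P[bc ac]].
  rewrite /available negb_or => /andP[TL ng].
  exact: (solve_roots (solveT _ (inT a b c) TL) wp pa pb pc).
rewrite negb_exists => /forallP hR.
case: (boolP [exists x : 'I_n * 'I_n,
    [&& p x.1 != x.1, p x.2 == x.2, x.2 != p x.1
      & ~~ available r s L w (p x.1) x.1 x.2]]).
  case/existsP=> -[j y] /= /and4P[pj /eqP py yj].
  rewrite /available negb_or => /andP[TL ng].
  exact: (solve_parent (solveT _ (inT (p j) j y) TL) wp pj py yj).
rewrite negb_exists => /forallP hP.
(* No required clause is missing, so the dag refutation applies at this node. *)
have [||t [dt nt]] := dag_refutation v0 (L := L) n0 wp (r := r) (s := s).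
- move=> a b c pa pb pc ab bc ac; apply: contraNT (hR (a, b, c)) => /= ->.
  by rewrite pa pb pc ab bc ac !eqxx.
- move=> j i pj pi ij; apply: contraNT (hP (j, i)) => /= ->.
  by rewrite pj pi ij eqxx.
exists t; split; rewrite ?sub0set //; rewrite leq_add // leq_mul2l.
by rewrite unlearnedS ?subsetUl ?orbT.
Qed.

Lemma unlearned_max L : unlearned L <= n ^ 3.
Proof.
apply: leq_trans (subset_leq_card (subsetDl _ _)) _.
apply: leq_trans (leq_imset_card _ _) _.
by rewrite !card_prod !card_ord !expnS expn0 muln1 mulnA.
Qed.

Lemma pool_refutation_GGT : 0 < n ->
  exists t, pool_refutation F t /\ num_nodes t <= dag_size + weight * n ^ 3.
Proof.
(* With nothing assigned all elements are minimal, and no literal is falsified, so the root label is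
   empty. *)
move=> n0; have f0 : forest (fun _ _ => false) (@id 'I_n).
  by split=> // i; rewrite eqxx.
have [t [[tv tr _ _ hhi] _ nt]] := solve set0 n0 f0.
exists t; split.
  apply: valid_pool_refutation => //.
  apply: (@clause_ext _ v0) => i j ij; rewrite inE.
  by apply/negP=> /(hhi _ _ ij).
apply: leq_trans (leq_addr _ _) (leq_trans nt _).
by rewrite leq_add2l leq_mul2l unlearned_max orbT.
Qed.

End Search.

(** With x = (n+1)^3, [dag_size n] is at most 4x and [weight n] at most 12x + 12x = 24x; then 4x +
    24x^2 <= 28x^2. *)
Lemma size_bound n : dag_size n + weight n * n ^ 3 <= 28 * (n + 1) ^ 6.
Proof.
have hd : dag_size n <= 4 * (n + 1) ^ 3.
  by rewrite /dag_size !expnS expn0 muln1; nia.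
have hn : n + 1 <= (n + 1) ^ 3 by rewrite -{1}[n + 1]expn1 leq_pexp2l // addn1.
have hw : weight n <= 24 * (n + 1) ^ 3.
  rewrite /weight; move: hd hn; move: dag_size ((n + 1) ^ 3) => d x.
  by move: (d n) => y; clear; lia.
have hx : n ^ 3 <= (n + 1) ^ 3 by rewrite leq_exp2r // leq_addr.
have h1 : 0 < (n + 1) ^ 3 by rewrite expn_gt0 addn1.
rewrite (expnD _ 3 3); have := leq_mul hw hx.
move: (weight n * n ^ 3) hd h1; move: (dag_size n) ((n + 1) ^ 3) => y x.
by clear; nia.
Qed.

Theorem theorem1 :
  exists p : {poly nat},
    forall (n : nat) (r s : 'I_n -> 'I_n -> 'I_n -> 'I_n),
      2 <= n -> guard_functions r s ->
      exists t : rtree (gvar n),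
        pool_refutation (GGT r s) t /\ num_nodes t <= (p.[n])%R.
Proof.
exists (28%:R *: ('X + 1) ^+ 6)%R => n r s n2 rs.
have v0 : gvar n.
  (* Two distinct elements provide the default variable [v0]. *)
  by case: n n2 {r s rs} => [|[|n]] // _; exists (ord0, ord_max).
have [t [ht nt]] := pool_refutation_GGT v0 rs (ltnW n2).
exists t; split=> //; apply: leq_trans nt _; apply: leq_trans (size_bound n) _.
by rewrite hornerZ horner_exp hornerD hornerX hornerC natn natrXE.
Qed.
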